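(* Let $\mathcal{H}$ be a separable Hilbert space, let $T_i:\mathcal{H}\to\mathcal{H}$ be $\alpha_i$-averaged for every $i\in I$ with $\alpha_i\le\alpha$ for some $\alpha<1$, assume $C\ne\emptyset$, and suppose there exists $\kappa>0$ such that $$\operatorname{dist}^2(x,C)\le\kappa R(x)\qquad\forall x\in\mathcal{H}.$$ Let $(X_k)$ be generated by $X_0\sim\mu$, $X_{k+1}=T_{\xi_k}X_k$. Then there is a random variable $X$ such that $X_k\to X$ strongly almost surely as $k\to\infty$, and the Wasserstein distances converge geometrically: there is $r\in(0,1)$ such that, for all $k\in\mathbb{N}_0$, $$W(\mathcal{L}(X_k),\mathcal{L}(X))\le 2r^k\,W(\mathcal{L}(X_0),\mathcal{L}(X)).$$ (The right-hand side may be $+\infty$, depending on $\mu$.)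
   Context: Setting: $G=\mathcal{H}$ is a Hilbert space with norm $\|\cdot\|$ and Borel $\sigma$-algebra $\mathcal{B}(G)$; $(I,\mathcal{I})$ is a measurable space; $(T_i)_{i\in I}$ is a family of continuous maps $T_i:G\to G$ such that $\Phi:G\times I\to G$, $\Phi(x,i)=T_ix$, is measurable. $(\Omega,\mathcal{F},\mathbb{P})$ is a probability space, $\xi:\Omega\to I$ is measurable, and $(\xi_k)_{k\in\mathbb{N}_0}$ are i.i.d. with the same distribution as $\xi$. $\mu$ is a probability measure on $(G,\mathcal{B}(G))$, $X_0$ is a $G$-valued random variable with law $\mu$, and $X_0,\xi_0,\dots,\xi_k$ are independent for every $k\in\mathbb{N}_0$. The random function iteration is $X_{k+1}=T_{\xi_k}X_k$, $k\in\mathbb{N}_0$. $\operatorname{Fix}T_i=\{x\in G: T_ix=x\}$ and $C:=\{x\in G:\mathbb{P}(x\in\operatorname{Fix}T_\xi)=1\}$; the standing assumption is $C\ne\emptyset$. $R(x):=\mathbb{E}[\|x-T_\xi x\|^2]$ and $\operatorname{dist}(x,C)=\inf_{c\in C}\|x-c\|$. A map $T:\mathcal{H}\to\mathcal{H}$ is $\alpha$-averaged, $\alpha\in(0,1)$, if $\|Tx-Ty\|^2+\frac{1-\alpha}{\alpha}\|(x-Tx)-(y-Ty)\|^2\le\|x-y\|^2$ for all $x,y\in\mathcal{H}$. $\mathcal{L}(X)$ denotes the law of $X$. For probability measures $\nu_1,\nu_2$ on $\mathcal{H}$, $W(\nu_1,\nu_2)=\inf\{\mathbb{E}[\|Y_1-Y_2\|]: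 Y_1\sim\nu_1,\ Y_2\sim\nu_2\}\in[0,\infty]$, the infimum being over all couplings $(Y_1,Y_2)$. *)

(* Defs.v *)
From HB Require Import structures.
From mathcomp Require Import all_boot all_order all_algebra.
From mathcomp Require Import all_classical all_reals all_analysis.

Set Implicit Arguments.
Unset Strict Implicit.
Unset Printing Implicit Defensive.

Import Order.TTheory GRing.Theory Num.Theory.
Import numFieldNormedType.Exports.

Local Open Scope classical_set_scope.
Local Open Scope ring_scope.

(* The norm comes from an inner product.  A complex Hilbert space is covered
   through its underlying real space with inner product [Re <x, y>], which has
   the same norm. *)
Definition hilbert_space (R : realType) (H : completeNormedModType R) : Prop :=
  exists dot : {dot H for @idfun R}, forall x : H, `|x| ^+ 2 = dot x x.

Definition separable_space (T : topologicalType) : Prop :=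
  exists2 D : set T, countable D & dense D.

Notation borel H := (g_sigma_algebraType (@open H)).

Definition averaged (R : realType) (H : normedModType R) (a : R) (T : H -> H) :
    Prop :=
  0 < a < 1 /\
  forall x y : H,
    `|T x - T y| ^+ 2 + (1 - a) / a * `|(x - T x) - (y - T y)| ^+ 2
      <= `|x - y| ^+ 2.

(* A real infimum, hence only meaningful when [C] is nonempty. *)
Definition dist (R : realType) (H : normedModType R) (x : H) (C : set H) : R :=
  inf [set `|x - c| | c in C].

Definition Fix (U : Type) (T : U -> U) : set U := [set x | T x = x].

(* Independence of a finite family of sigma-algebras of events. *)
Definition mutually_independent (d : measure_display) (Omega : measurableType d)
    (R : realType) (P : probability Omega R) (J : finType)
    (F : J -> set (set Omega)) : Prop :=
  forall (K : {set J}) (A : J -> set Omega), (forall j, j \in K -> F j (A j)) ->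
    P (\bigcap_(j in [set` K]) A j) = (\prod_(j in K) P (A j))%E.

Definition has_law (d d' : measure_display) (Omega : measurableType d)
    (E : measurableType d') (R : realType) (P : probability Omega R)
    (X : {RV P >-> E}) (nu : probability E R) : Prop :=
  forall A : set E, measurable A -> distribution P X A = nu A.

Section random_function_iteration.
Context (R : realType) (H : completeNormedModType R).
Context (d d' : measure_display) (Omega : measurableType d)
  (I : measurableType d') (P : probability Omega R).
Implicit Types (T : I -> H -> H) (xi : {RV P >-> I}).

Definition stochastic_fix T xi : set H :=
  [set x | P [set w | Fix (T (xi w)) x] = 1%E].

Definition residual T xi (x : H) : \bar R :=
  ('E_P[fun w => (`|x - T (xi w) x| ^+ 2)%R])%E.

(* The sigma-algebras generated by X0 (index [None]) and by xi_0, ..., xi_k. *)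
Definition sigma_inputs (X0 : {RV P >-> borel H}) (xi_ : nat -> {RV P >-> I})
    (k : nat) (j : option 'I_k.+1) : set (set Omega) :=
  if j is Some i then g_sigma_algebra_preimage (xi_ i)
  else g_sigma_algebra_preimage X0.

End random_function_iteration.

(* The infimum ranges over all probability spaces [Omega, P] carrying a
   coupling.  Laws are compared on Borel sets only, since a [probability] is
   unconstrained elsewhere. *)
Definition wasserstein (R : realType) (H : completeNormedModType R)
    (nu1 nu2 : probability (borel H) R) : \bar R :=
  ereal_inf [set z : \bar R |
    exists (d : measure_display) (Omega : measurableType d)
           (P : probability Omega R) (Y1 Y2 : {RV P >-> borel H}),
      [/\ has_law Y1 nu1, has_law Y2 nu2 &
          z = ('E_P[fun w => `|(Y1 w : H) - (Y2 w : H)|%R])%E]].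

(* Main.v *)
(* Let [f] be the distance to [C], [b = (1 - alpha) / alpha] and
   [d = f x].  If [T_i] fixes every point of [C], which by separability happens
   almost surely, averagedness gives [f (T_i x)^2 + b |x - T_i x|^2 <= d^2],
   hence [f (T_i x) + b / (2 d) |x - T_i x|^2 <= d].  Integrating over [i] and
   using [d^2 <= kappa R(x)] (with [kappa] enlarged so that [b <= kappa]) yields
   [E f(T_xi x) <= r f(x)] with [r = 1 - b / (2 kappa)].  Since [xi_k] is
   independent of [(X_0, X_k)], [E (g(X_0) f(X_k)) <= r^k E (g(X_0) f(X_0))] for
   every weight [g >= 0].

   With [g = 1 / (1 + f)] this forces [inf_k f(X_k) = 0] almost surely; as
   [X_k] is Fejer monotone with respect to [C], it converges to some [X] in [C]
   and [|X_k - X| <= 2 f(X_k)].  With [g = 1],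
   [W(X_k, X) <= 2 E f(X_k) <= 2 r^k E f(X_0)], and [E f(X_0) <= W(X_0, X)]
   because every coupling puts its second marginal in [C]. *)

Require Import Defs.
From HB Require Import structures.
From mathcomp Require Import all_boot all_order all_algebra.
From mathcomp Require Import all_classical all_reals all_analysis.
From mathcomp Require Import measurable_realfun ring lra.

Set Implicit Arguments.
Unset Strict Implicit.
Unset Printing Implicit Defensive.

Import Order.TTheory GRing.Theory Num.Theory.
Import numFieldNormedType.Exports.

Local Open Scope classical_set_scope.
Local Open Scope ring_scope.

(** * Distance to a set, and separability of subsets *)

Section dist.
Context (R : realType) (H : normedModType R).
Implicit Types (x y c : H) (C : set H).

Lemma dist_le x C c : C c -> dist x C <= `|x - c|.
Proof.
move=> Cc; apply: ge_inf; last by exists c.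
by exists 0 => _ [z _ <-].
Qed.

Lemma le_dist x C a :
  C !=set0 -> (forall c, C c -> a <= `|x - c|) -> a <= dist x C.
Proof.
move=> [c Cc] aC; apply: lb_le_inf; first by exists `|x - c|, c.
by move=> _ [z Cz <-]; exact: aC.
Qed.

Lemma dist_ge0 x C : 0 <= dist x C.
Proof.
(* For empty [C] the real infimum takes its default value [0]. *)
have [->|/set0P C0] := eqVneq C set0; first by rewrite /dist image_set0 inf0.
exact: le_dist.
Qed.

Lemma dist_ltP x C a :
  C !=set0 -> dist x C < a -> exists2 c, C c & `|x - c| < a.
Proof.
move=> C0 dxa; apply: contrapT => nex; move: dxa; apply/negP; rewrite -leNgt.
apply: le_dist => // c Cc; rewrite leNgt; apply/negP => xca.
by apply: nex; exists c.
Qed.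

Lemma dist_lipschitz x y C : dist x C <= `|x - y| + dist y C.
Proof.
have [->|/set0P C0] := eqVneq C set0.
  by rewrite /dist !image_set0 inf0 addr0.
rewrite -lerBlDl; apply: le_dist => // c Cc; rewrite lerBlDl.
apply: le_trans (dist_le x Cc) _.
by rewrite -[x - c](subrKA y) ler_normD.
Qed.

Lemma dist_continuous C : continuous (fun x => dist x C).
Proof.
move=> x; apply/cvgrPdist_lt => e e0; near=> y.
have xye : `|x - y| < e by near: y; exact: cvgr_dist_lt.
rewrite ltr_norml; apply/andP; split.
- rewrite ltrNl opprB ltrBlDr; apply: le_lt_trans (dist_lipschitz y x C) _.
  by rewrite distrC ltrD2r.
- rewrite ltrBlDr; apply: le_lt_trans (dist_lipschitz x y C) _.
  by rewrite ltrD2r.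
Unshelve. all: by end_near. Qed.

Lemma dist_eq0 x C : closed C -> C !=set0 -> dist x C = 0 -> C x.
Proof.
move=> cC C0 dx0; apply: cC => B /nbhs_ballP[e /= e0 xeB].
have [|c Cc xce] := @dist_ltP x C e C0; first by rewrite dx0.
by exists c; split => //; apply: xeB; rewrite -ball_normE.
Qed.

Lemma dist_mem0 x C : C x -> dist x C = 0.
Proof.
move=> Cx; apply/eqP; rewrite eq_le dist_ge0 andbT.
by apply: le_trans (dist_le x Cx) _; rewrite subrr normr0.
Qed.

(* [s n] is empty or a singleton, so that [C] may be empty. *)
Lemma separable_subset C : separable_space H ->
  exists2 s : nat -> set H, (forall n, s n `<=` C /\ is_subset1 (s n)) &
    forall c e, C c -> 0 < e -> exists n, exists2 q, s n q & `|c - q| < e.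
Proof.
move=> [D /countable_injP[j /= jinj] dD].
(* [j] numbers the points of [D]. For each point of [D] and each radius [1 / (n + 1)], one point of
   [C] within that radius is selected if there is any; the pair [p] codes the centre and the
   radius. *)
pose ok (p : nat * nat) q := C q /\ exists z, [/\ D z, j z = p.1 &
  `|z - q| < p.2.+1%:R^-1].
have chooses p : exists t : set H, [/\ t `<=` C, is_subset1 t,
    (forall q, t q -> ok p q) & (exists q, ok p q) -> t !=set0].
  have [[q okq]|nok] := pselect (exists q, ok p q).
    exists [set q]; split.
    - by move=> _ ->; case: okq.
    - by move=> _ _ -> ->.
    - by move=> _ ->.
    - by move=> _; exists q.
  by exists set0; split=> // -[].
have /choice[t tP] := chooses.
exists (fun n => if unpickle n is Some p then t p else set0).
  move=> n; case: (unpickle n) => [p|]; last by split.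
  by have [] := tP p.
move=> c e Cc e0.
have [n ne] : exists n, n.+1%:R^-1 < e / 2.
  have := near_infty_natSinv_lt (PosNum (divr_gt0 e0 (@ltr0n R 2))).
  by move=> [n _ /(_ n (leqnn n))]; exists n.
have [z [cz Dz]] : (ball c (n.+1%:R^-1 : R) `&` D) !=set0.
  apply: dD; last exact: ball_open.
  by exists c; apply: ballxx.
have [tC t1 tok t0] := tP (j z, n).
have okc : ok (j z, n) c.
  split => //; exists z; split => //.
  by move: cz; rewrite -ball_normE /= distrC.
have [|q tq] := t0; first by exists c.
exists (pickle (j z, n)); rewrite pickleK; exists q => //.
have [_ [z' [Dz' jz' z'q]]] := tok _ tq.
have zz' : z' = z by apply: jinj; rewrite ?inE.
rewrite zz' in z'q; rewrite -[c - q](subrKA z).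
apply: le_lt_trans (ler_normD _ _) _; rewrite (splitr e).
move: cz; rewrite -ball_normE /= => cz.
by apply: ltrD; exact: lt_trans ne.
Qed.

End dist.

(** * Measurability for the Borel sigma-algebra of the norm topology *)

Section borel.
Context (R : realType) (H : normedModType R).

Lemma continuous_borel_measurable (f : H -> R) :
  continuous f -> measurable_fun [set: borel H] f.
Proof.
move=> /continuousP cf; apply: (measurability _ (RGenOpens.measurableE R)).
move=> _ [_ [a [b ->] <-]]; rewrite setTI; apply: sub_sigma_algebra.
exact/cf/interval_open.
Qed.

Lemma measurable_dist (C : set H) :
  measurable_fun [set: borel H] (fun x => dist (x : H) C).
Proof. exact: (continuous_borel_measurable (@dist_continuous _ _ C)). Qed.

Lemma open_borel_measurable (U : set H) :
  open U -> measurable (U : set (borel H)).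
Proof. exact: sub_sigma_algebra. Qed.

Lemma closed_borel_measurable (U : set H) :
  closed U -> measurable (U : set (borel H)).
Proof.
move=> cU; rewrite -(setCK U); apply: measurableC.
by apply: open_borel_measurable; exact: closed_openC.
Qed.

(* [U] open is [{0 < dist _ (~` U)}], which turns the limit into a real one. *)
Lemma borel_measurable_cvg d (E : measurableType d) (h : nat -> E -> borel H)
    (f : E -> borel H) :
  (forall n, measurable_fun [set: E] (h n)) ->
  (forall w, (fun n => h n w : H) @ \oo --> (f w : H)) ->
  measurable_fun [set: E] f.
Proof.
move=> mh hf; apply: (@measurability _ _ E (borel H) setT f (@open H)) => //.
move=> _ [U oU <-]; rewrite setTI.
have [UT|/set0P UC0] := eqVneq (~` U) set0.
  by rewrite -(setCK U) UT setC0 preimage_setT.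
have mF : measurable_fun [set: E] (fun w => dist (f w : H) (~` U)).
  apply: (@measurable_fun_cvg _ _ _ _ (fun n w => dist (h n w : H) (~` U))).
    by move=> n; exact: measurableT_comp (measurable_dist _) (mh n).
  move=> w _; have := @dist_continuous _ _ (~` U) (f w : H).
  exact: cvg_comp (hf w).
rewrite (_ : _ @^-1` _ =
    [set: E] `&` (fun w => dist (f w : H) (~` U)) @^-1` `]0, +oo[%classic).
  exact: mF.
rewrite setTI; apply/seteqP; split => w /=; rewrite in_itv /= andbT.
- move=> Ufw; rewrite lt_neqAle dist_ge0 andbT; apply/eqP => /esym/dist_eq0.
  by apply => //; exact: open_closedC.
- move=> d0; apply: contrapT => /(@dist_mem0 _ _ _ (~` U)) d1.
  by rewrite d1 ltxx in d0.
Qed.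

(** In a separable space [|x - y|] is the supremum of [|x - q| - |y - q|] over countably many dense
    [q], so each superlevel set is a countable union of sets given by real measurable functions. *)
Lemma measurable_fun_norm_sub d (E : measurableType d) (f g : E -> borel H) :
  separable_space H ->
  measurable_fun [set: E] f -> measurable_fun [set: E] g ->
  measurable_fun [set: E] (fun w => `|(f w : H) - (g w : H)|).
Proof.
move=> sepH mf mg.
have [s sC sH] := separable_subset [set: H] sepH.
apply: (measurability _ (RGenOInfty.measurableE R)).
move=> _ [_ [a ->] <-]; rewrite setTI.
rewrite (_ : _ @^-1` _ = \bigcup_n \bigcup_(q in s n)
  [set w | a < `|(f w : H) - q| - `|(g w : H) - q| ]).
  apply: bigcup_measurable => n _.
  have [->|/set0P[q sq]] := eqVneq (s n) set0.
    by rewrite bigcup_set0.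
  rewrite (_ : s n = [set q]); last first.
    by apply/seteqP; split => [x sx|_ -> //]; exact: (sC n).2.
  rewrite bigcup_set1.
  have mn (h : E -> borel H) : measurable_fun [set: E] h ->
      measurable_fun [set: E] (fun w => `|(h w : H) - q|).
    move=> mh; have cq : continuous (fun x : H => `|x - q|).
      by move=> x; apply: cvg_norm; apply: cvgB => //; exact: cvg_cst.
    exact: measurableT_comp (continuous_borel_measurable cq) mh.
  rewrite (_ : [set _ | _] = [set: E] `&`
      (fun w => `|(f w : H) - q| - `|(g w : H) - q|) @^-1` `]a, +oo[%classic).
    exact: measurable_funB (mn _ mf) (mn _ mg) measurableT _ (measurable_itv _).
  by rewrite setTI; apply/seteqP; split => w /=; rewrite in_itv /= andbT.
apply/seteqP; split => w /=; rewrite in_itv /= andbT.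
- move=> afg.
  (* By the triangle inequality, replacing [g w] by [q] costs at most [2 |g w - q|], hence half of
     the gap above [a]. *)
  have [|n [q sq gq]] := sH (g w) ((`|(f w : H) - g w| - a) / 2) I.
    by rewrite divr_gt0 // subr_gt0.
  exists n => //; exists q => //=.
  have := ler_distD q (f w : H) (g w : H); rewrite (distrC q).
  by move: gq; lra.
- move=> [n _ [q sq]] /= h; apply: (lt_le_trans h); rewrite lerBlDr.
  exact: ler_distD.
Qed.

End borel.

(** * Independence: product laws, and the past of the iteration *)

Lemma ge0_integral_independent (R : realType) d d1 d2 (Om : measurableType d)
    (E1 : measurableType d1) (E2 : measurableType d2) (P : probability Om R)
    (Y : {RV P >-> E1}) (Z : {RV P >-> E2}) (F : E1 * E2 -> \bar R) :
  (forall A B, measurable A -> measurable B ->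
    P (Y @^-1` A `&` Z @^-1` B) = P (Y @^-1` A) * P (Z @^-1` B))%E ->
  measurable_fun [set: E1 * E2] F -> (forall p, 0 <= F p)%E ->
  (\int[P]_w F (Y w, Z w) = \int[P]_w \int[distribution P Z]_z F (Y w, z))%E.
Proof.
move=> YZ mF F0.
have mYZ : measurable_fun [set: Om] (fun w => (Y w, Z w)).
  by apply: measurable_fun_pair; exact: measurable_funP.
pose YZ_ : {RV P >-> (E1 * E2)%type} := mfun_Sub (mem_set mYZ).
rewrite -[LHS](@ge0_integral_distribution _ _ _ _ _ _ YZ_ F)//.
(* By independence the joint law agrees with the product law on rectangles, hence everywhere;
   Tonelli then integrates over [Z] first. *)
rewrite (eq_measure_integral (distribution P Y \x distribution P Z)%E).
  rewrite fubini_tonelli1//.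
  rewrite ge0_integral_distribution//.
    exact: measurable_fun_fubini_tonelli_F.
  by move=> y; exact: integral_ge0.
move=> A mA _; apply/esym/product_measure_unique => //.
Qed.

Section independence.
Context (R : realType) (H : completeNormedModType R).
Context d d' (Om : measurableType d) (I : measurableType d').
Context (P : probability Om R).
Context (X0 : {RV P >-> borel H}) (xi_ : nat -> {RV P >-> I}).

(* Events [A_0 /\ ... /\ A_k] with [A_0] an event of [X0] and [A_j.+1] one of
   [xi_ j], [j < k]: a pi-system generating the sigma-algebra of these
   inputs. *)
Definition past k : set (set Om) :=
  [set \bigcap_(j in [set` [set~ (Some ord_max : option 'I_k.+1)]%SET]) A j |
    A in [set A : option 'I_k.+1 -> set Om |
           forall j, sigma_inputs X0 xi_ j (A j)]].

Lemma sigma_inputs_measurable k (j : option 'I_k.+1) :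
  sigma_inputs X0 xi_ j `<=` measurable.
Proof.
by case: j => [j|] A [B mB <-]; rewrite setTI -(setTI (_ @^-1` _));
  exact: measurable_funP.
Qed.

Lemma sigma_inputsI k (j : option 'I_k.+1) :
  setI_closed (sigma_inputs X0 xi_ j).
Proof.
by case: j => [j|] A B [A' mA' <-] [B' mB' <-]; exists (A' `&` B');
  rewrite ?preimage_setI ?setTI//; exact: measurableI.
Qed.

Lemma past_measurable k : past k `<=` measurable.
Proof.
move=> _ [A inA <-]; apply: fin_bigcap_measurable => [|j _].
  exact: finite_finset.
exact: sigma_inputs_measurable (inA j).
Qed.

Lemma pastI k : setI_closed (past k).
Proof.
move=> _ _ [A inA <-] [B inB <-]; exists (fun j => A j `&` B j).
  by move=> j; exact: sigma_inputsI.
by rewrite bigcapI.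
Qed.

Lemma sigma_inputsT k (j : option 'I_k.+1) : sigma_inputs X0 xi_ j setT.
Proof. by case: j => [j|]; exists setT; rewrite ?preimage_setT ?setTI. Qed.

Lemma sub_past k (j : option 'I_k.+1) :
  j != Some ord_max -> sigma_inputs X0 xi_ j `<=` past k.
Proof.
move=> jk A jA; exists (fun i => if i == j then A else setT).
  by move=> i /=; case: eqP => [->//|_]; exact: sigma_inputsT.
apply/seteqP; split => [w /(_ j)|w Aw i _] /=; last by case: eqP.
by rewrite eqxx; apply; rewrite !inE.
Qed.

Lemma pastT k : past k setT.
Proof. by apply: (@sub_past k None) => //; exact: sigma_inputsT. Qed.

(** As functions of [A] both sides are finite measures: a restriction of [P] and a multiple of [P].
    Mutual independence makes them agree on the pi-system [past k], hence on the sigma-algebra it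
    generates. *)
Lemma independent_past k A B :
  mutually_independent P (sigma_inputs X0 xi_ (k := k)) ->
  <<s past k >> A -> measurable B ->
  (P (A `&` xi_ k @^-1` B) = P A * P (xi_ k @^-1` B))%E.
Proof.
move=> ind pastA mB; set E := xi_ k @^-1` B.
have mE : measurable E by rewrite -(setTI E); exact: measurable_funP.
have PE : (P E \is a fin_num)%E by exact: fin_num_measure.
have PE0 : 0 <= fine (P E) by exact: fine_ge0.
pose m1 : {measure set Om -> \bar R} := mrestr P mE.
pose m2 : {measure set Om -> \bar R} := mscale (NngNum PE0) P.
suff -> : P (A `&` E) = m2 A by rewrite /m2/= /mscale/= fineK// muleC.
apply: (@g_sigma_algebra_measure_unique _ _ _ (past k) (@past_measurable k)
  (fun=> setT) _ _ m1 m2) => //.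
- by move=> _; exact: pastT.
- by rewrite bigcup_const //; exists 0%N.
- exact: pastI.
- move=> _ [F inF <-]; rewrite /m1/= /m2/= /mscale/= /mrestr fineK//.
  (* The index [Some ord_max] belongs to [xi_ k]. With [E] placed there, mutual independence is
     applied twice: to all indices, and to all but this one. *)
  pose F' j := if j == Some ord_max then E else F j.
  have inF' j : sigma_inputs X0 xi_ j (F' j).
    rewrite /F'; case: eqP => [->|_]; last exact: inF.
    by exists B => //; rewrite setTI.
  have FF' : \bigcap_(j in [set` [set~ (Some ord_max : option 'I_k.+1)]%SET]) F j =
      \bigcap_(j in [set` [set~ (Some ord_max : option 'I_k.+1)]%SET]) F' j.
    by apply: eq_bigcapr => j /=; rewrite /F' !inE => /negbTE ->.
  have := ind [set: option 'I_k.+1]%SET F' (fun j _ => inF' j).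
  rewrite (bigD1 (Some ord_max)) ?inE//=.
  rewrite {2}/F' eqxx => indT.
  rewrite FF' (ind _ F') => [|j _]; last exact: inF'.
  transitivity (P (\bigcap_(j in [set` [set: option 'I_k.+1]%SET]) F' j)).
    congr (P _); apply/seteqP; split => w.
      move=> [Fw Ew] j _; have [->|jk] := eqVneq j (Some ord_max).
        by rewrite /F' eqxx.
      by apply: Fw; rewrite /= !inE.
    move=> Fw; split; first by move=> j _; apply: Fw; rewrite /= inE.
    have : F' (Some ord_max) w by apply: Fw; rewrite /= inE.
    by rewrite /F' eqxx.
  rewrite indT; congr (_ * _)%E.
  by apply: eq_bigl => j; rewrite !inE.
- by move=> _; rewrite /m1/= /mrestr setTI; rewrite ltey_eq PE.
Qed.

End independence.

(** The sigma-algebra on [E] is left free so that it can be the one generated by [past k]; only the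
    [xi_ j] with [j < k] are measurable for it. *)
Lemma iteration_measurable (R : realType) (H : normedModType R) d d'
    (E : measurableType d) (I : measurableType d') (T : I -> H -> H)
    (X_ : nat -> E -> borel H) (xi_ : nat -> E -> I) k :
  measurable_fun [set: borel H * I] (fun p => T p.2 p.1 : borel H) ->
  measurable_fun [set: E] (X_ 0%N) ->
  (forall j, (j < k)%N -> measurable_fun [set: E] (xi_ j)) ->
  (forall j w, X_ j.+1 w = T (xi_ j w) (X_ j w)) ->
  measurable_fun [set: E] (X_ k).
Proof.
move=> mT mX0; elim: k => [//|k IH] mxi XS.
have -> : X_ k.+1 =
    (fun p => T p.2 p.1 : borel H) \o (fun w => (X_ k w, xi_ k w)).
  by apply/funext => w /=; rewrite XS.
apply: measurableT_comp => //; apply: measurable_fun_pair; last exact: mxi.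
by apply: IH => // j jk; apply: mxi; exact: ltnW.
Qed.

(** * Fejer monotone sequences and averaged maps *)

Lemma fejer_cvg (R : realType) (H : completeNormedModType R) (C : set H)
    (u : nat -> H) :
  closed C -> C !=set0 ->
  (forall c k, C c -> `|u k.+1 - c| <= `|u k - c|) ->
  (forall e, 0 < e -> exists k, dist (u k) C < e) ->
  exists l, [/\ C l, u @ \oo --> l & forall k, `|u k - l| <= 2 * dist (u k) C].
Proof.
move=> cC C0 uC u0.
have decr c k m : C c -> (k <= m)%N -> `|u m - c| <= `|u k - c|.
  move=> Cc /subnK <-; elim: (m - k)%N => // n IH.
  by rewrite addSn; apply: le_trans IH; exact: uC.
(* A point of [C] close to one iterate stays as close to all later ones. *)
have /cauchy_cvg/cvg_ex[l ul] : cauchy (u @ \oo).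
  apply: cauchy_exP => e e0.
  have [k /(dist_ltP C0)[c Cc ukc]] := u0 e e0.
  exists c; exists k => // m /= km.
  by rewrite -ball_normE /= distrC; apply: le_lt_trans ukc; exact: decr.
(* For [m >= k], going from [u k] to [u m] through [c] costs at most [2 |u k - c|]; let [m] tend to
   infinity, then take the infimum over [c]. *)
have ukl k : `|u k - l| <= 2 * dist (u k) C.
  rewrite -ler_pdivrMl//; apply: le_dist => // c Cc; rewrite ler_pdivrMl//.
  have cul : (fun n => `|u k - u n|) @ \oo --> `|u k - l|.
    by apply: cvg_norm; apply: cvgB => //; exact: cvg_cst.
  apply: (closed_cvg (fun x => x <= 2 * `|u k - c|) _ _ _ cul).
    exact: closed_le.
  exists k => // m /= km; apply: le_trans (ler_distD c _ _) _.
  by rewrite mulr2n mulrDl mul1r lerD2l distrC decr.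
exists l; split => //; apply: dist_eq0 => //.
apply/eqP; rewrite eq_le dist_ge0 andbT; apply/ler_addgt0Pl => e e0.
rewrite addr0.
(* The distance from [l] to [C] is at most [|l - u k| + dist (u k) C], that is, at most three times
   [dist (u k) C]. *)
have [|k uke] := u0 (e / 3); first by rewrite divr_gt0.
apply: le_trans (dist_lipschitz l (u k) C) _; rewrite distrC.
apply: le_trans (lerD (ukl k) (lexx _)) _.
have -> : 2 * dist (u k) C + dist (u k) C = dist (u k) C * 3 by ring.
by rewrite -ler_pdivlMr//; exact: ltW.
Qed.

Lemma averaged_nonexpansive (R : realType) (H : normedModType R) a
    (T : H -> H) (x y : H) : averaged a T -> `|T x - T y| <= `|x - y|.
Proof.
move=> [/andP[a0 a1] /(_ x y) h].
rewrite -(@ler_pXn2r _ 2) ?nnegrE//; apply: le_trans h.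
by rewrite lerDl mulr_ge0 ?sqr_ge0// divr_ge0 ?ltW// subr_gt0.
Qed.

(** The infimum over [c] gives [f^2 + b p <= d^2]. Since [2 d f <= d^2 + f^2], dividing by [2 d]
    makes the estimate linear in the distances, as needed for first moments. *)
Lemma dist_averaged (R : realType) (H : normedModType R) (C : set H) (b : R)
    (T : H -> H) (x : H) :
  C !=set0 -> 0 <= b -> (forall c, C c -> T c = c) ->
  (forall c, C c -> `|T x - T c| ^+ 2 + b * `|(x - T x) - (c - T c)| ^+ 2
     <= `|x - c| ^+ 2) ->
  dist (T x) C + b / (2 * dist x C) * `|x - T x| ^+ 2 <= dist x C.
Proof.
move=> C0 b0 TC Tx; set f := dist (T x) C; set d := dist x C.
set p := `|x - T x| ^+ 2.
have f0 : 0 <= f := dist_ge0 _ _; have d0 : 0 <= d := dist_ge0 _ _.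
have p0 : 0 <= p by exact: sqr_ge0.
have s0 : 0 <= f ^+ 2 + b * p by rewrite addr_ge0 ?sqr_ge0 ?mulr_ge0.
have sd : f ^+ 2 + b * p <= d ^+ 2.
  (* The infimum is of distances and not of squares, so the square root of the left side is shown to
     be a lower bound. *)
  rewrite -[leLHS]sqr_sqrtr// ler_pXn2r ?nnegrE ?sqrtr_ge0//.
  apply: le_dist => // c Cc; rewrite -(@ler_pXn2r _ 2) ?nnegrE ?sqrtr_ge0//.
  rewrite sqr_sqrtr//; apply: le_trans (Tx c Cc).
  rewrite (TC c Cc) subrr subr0 lerD2r ler_pXn2r ?nnegrE//.
  exact: dist_le.
(* Here [b / (2 * d)] is [0] because [0^-1 = 0], and what remains is [f <= 0]. *)
have [d00|dn0] := eqVneq d 0.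
  rewrite d00 mulr0 invr0 mulr0 mul0r addr0.
  rewrite -(@ler_pXn2r _ 2) ?nnegrE//; rewrite d00 in sd.
  by apply: le_trans sd; rewrite lerDl mulr_ge0.
have dp : 0 < d by rewrite lt_def dn0.
have -> : f + b / (2 * d) * p = (2 * d * f + b * p) / (2 * d) by field.
rewrite ler_pdivrMr ?mulr_gt0//.
have : 0 <= (d - f) ^+ 2 by exact: sqr_ge0.
by nra.
Qed.

(** * Integrals and almost sure statements under a law *)

Lemma has_law_ge0_integral (R : realType) d d' (Om : measurableType d)
    (E : measurableType d') (P : probability Om R) (X : {RV P >-> E})
    (nu : probability E R) (f : E -> \bar R) :
  has_law X nu -> measurable_fun [set: E] f -> (forall x, 0 <= f x)%E ->
  (\int[P]_w f (X w) = \int[nu]_x f x)%E.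
Proof.
move=> Xnu mf f0; rewrite -[LHS](@ge0_integral_distribution _ _ _ _ _ P X f)//.
by apply: eq_measure_integral => A mA _; exact: Xnu.
Qed.

Lemma has_law_ae (R : realType) d d' (Om : measurableType d)
    (E : measurableType d') (P : probability Om R) (X : {RV P >-> E})
    (nu : probability E R) (Q : E -> Prop) :
  has_law X nu -> (\forall x \ae nu, Q x) -> \forall w \ae P, Q (X w).
Proof.
move=> Xnu [N [mN N0 QN]]; exists (X @^-1` N); split.
- by rewrite -(setTI (_ @^-1` _)); exact: measurable_funP.
- by rewrite -N0 -Xnu.
- by move=> w nQ; exact: QN.
Qed.

Lemma probability1P (R : realType) d (Om : measurableType d)
    (P : probability Om R) (A : set Om) : measurable A ->
  P A = 1%E <-> \forall w \ae P, A w.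
Proof.
move=> mA; have mAC := measurableC mA; split.
- move=> PA; exists (~` A); split => //.
  by rewrite probability_setC// PA subee.
- move=> /(negligibleP P mAC) PAC.
  by rewrite -[A]setCK probability_setC// PAC sube0.
Qed.

(** * The common fixed points, and the mean contraction of the distance to them *)

Section stochastic_fixed_points.
Context (R : realType) (H : completeNormedModType R).
Context d d' (Om : measurableType d) (I : measurableType d').
Context (P : probability Om R) (xi : {RV P >-> I}) (T : I -> H -> H).
Context (mT : measurable_fun [set: borel H * I] (fun p => T p.2 p.1 : borel H)).
Context (T1 : forall i x y, `|T i x - T i y| <= `|x - y|).
Context (sepH : separable_space H).

Let C := stochastic_fix T xi.

Lemma measurable_evalT (x : H) :
  measurable_fun [set: I] (fun i => T i x : borel H).
Proof. exact: (measurableT_comp mT (pair1_measurable (x : borel H))). Qed.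

Lemma measurable_Fix (x : H) : measurable [set i | Fix (T i) x].
Proof.
have c1 : closed [set x].
  exact/accessible_closed_set1/hausdorff_accessible/norm_hausdorff.
have := @measurable_evalT x measurableT _ (closed_borel_measurable c1).
by rewrite setTI.
Qed.

Lemma stochastic_fixP (x : H) :
  C x <-> \forall i \ae distribution P xi, Fix (T i) x.
Proof. exact: (probability1P (distribution P xi) (measurable_Fix x)). Qed.

(** Each [c] has its own null set. Countably many of them, for a dense subset of [C], suffice: a
    nonexpansive map fixing a dense subset of [C] fixes [C]. *)
Lemma ae_Fix_stochastic_fix :
  \forall i \ae distribution P xi, forall c, C c -> T i c = c.
Proof.
have [s sC sD] := separable_subset C sepH.
have : \forall i \ae distribution P xi, forall n q, s n q -> T i q = q.
  apply: ae_foralln => n.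
  have [sn0|/set0P[q sq]] := eqVneq (s n) set0.
    by apply: aeW => i q; rewrite sn0.
  have /stochastic_fixP : C q by exact: (sC n).1.
  by apply: filterS => i Tq r sr; rewrite ((sC n).2 r q).
apply: filterS => i Ts c Cc; apply/eqP; rewrite -subr_eq0 -normr_eq0.
rewrite eq_le normr_ge0 andbT; apply/ler_addgt0Pl => e e0; rewrite addr0.
have [|n [q sq cq]] := sD c (e / 2) Cc; first by rewrite divr_gt0.
apply: le_trans (ler_distD q _ _) _; rewrite -[in `|_ - q|](Ts n q)//.
rewrite (splitr e) lerD//; last by rewrite distrC ltW.
exact: le_trans (T1 _ _ _) (ltW cq).
Qed.

(** For almost every [i] the map [T i] fixes all of [C] and, being nonexpansive, also its
    closure. *)
Lemma closed_stochastic_fix : closed C.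
Proof.
move=> x Cx; apply/stochastic_fixP.
apply: filterS ae_Fix_stochastic_fix => i TC.
apply/eqP; rewrite -subr_eq0 -normr_eq0 eq_le normr_ge0 andbT.
apply/ler_addgt0Pl => e e0; rewrite addr0.
have [|c [Cc]] := Cx (ball x (e / 2)).
  by apply: nbhsx_ballx; rewrite divr_gt0.
rewrite -ball_normE /= => xc.
apply: le_trans (ler_distD c _ _) _; rewrite -[in `|_ - c|](TC c)//.
rewrite (splitr e) lerD//; last by rewrite distrC ltW.
exact: le_trans (T1 _ _ _) (ltW xc).
Qed.

Context (b kappa : R) (b0 : 0 < b).
Context (T_averaged : forall i x y,
  `|T i x - T i y| ^+ 2 + b * `|(x - T i x) - (y - T i y)| ^+ 2
    <= `|x - y| ^+ 2).
Context (C0 : C !=set0) (kappab : b <= kappa).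
Context (regularity :
  forall x, ((dist x C ^+ 2)%:E <= kappa%:E * residual T xi x)%E).

Lemma measurable_sqr_displacement x :
  measurable_fun [set: I] (fun i => (`|x - T i x| ^+ 2)%:E).
Proof.
have cx : continuous (fun y : H => `|x - y|).
  by move=> y; apply: cvg_norm; apply: cvgB => //; exact: cvg_cst.
apply/measurable_EFinP; apply: measurable_funX.
exact: measurableT_comp (continuous_borel_measurable cx) (measurable_evalT x).
Qed.

Lemma residualE x :
  residual T xi x = (\int[distribution P xi]_i (`|x - T i x| ^+ 2)%:E)%E.
Proof.
rewrite /residual unlock ge0_integral_distribution//.
exact: measurable_sqr_displacement.
Qed.

Lemma dist_contraction x :
  (\int[distribution P xi]_i (dist (T i x) C)%:E
    <= (1 - b / (2 * kappa))%:E * (dist x C)%:E)%E.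
Proof.
set d_ := dist x C.
have dx0 : 0 <= d_ := dist_ge0 _ _.
have k0 : 0 < kappa by exact: lt_le_trans kappab.
have mf : measurable_fun [set: I] (fun i => (dist (T i x) C)%:E).
  apply/measurable_EFinP.
  exact: measurableT_comp (measurable_dist C) (measurable_evalT x).
have mg := measurable_sqr_displacement x.
have a0 : 0 <= b / (2 * d_) by rewrite divr_ge0 ?mulr_ge0// ltW.
have : (\int[distribution P xi]_i (dist (T i x) C)%:E +
   (b / (2 * d_))%:E * residual T xi x <= d_%:E)%E.
  rewrite residualE -ge0_integralZl_EFin//.
  rewrite -ge0_integralD//; last 3 first.
  - by move=> i _; rewrite lee_fin dist_ge0.
  - by move=> i _; rewrite -EFinM lee_fin mulr_ge0 ?sqr_ge0.
  - exact: measurable_funeM.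
  have <- : (\int[distribution P xi]_i (cst d_%:E) i = d_%:E)%E.
    rewrite integral_cst//.
    by have /= -> := probability_setT (distribution P xi); rewrite mule1.
  apply: ae_ge0_le_integral => //.
  - move=> i _; rewrite adde_ge0// ?lee_fin ?dist_ge0//.
    by rewrite mulr_ge0 ?sqr_ge0.
  - by apply: emeasurable_funD => //; exact: measurable_funeM.
  - apply: filterS ae_Fix_stochastic_fix => i TC _.
    rewrite -EFinM -EFinD lee_fin; apply: dist_averaged => //.
      exact: ltW.
(* At distance [0] the coefficient of the residual defaults to [0], and the estimate is already the
   claim. *)
have [->|dn0] := eqVneq d_ 0.
  by rewrite mulr0 invr0 mulr0 mul0e adde0 mule0.
move=> h; have dp : 0 < d_ by rewrite lt_def dn0.
have : (\int[distribution P xi]_i (dist (T i x) C)%:E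
   + (b * d_ / (2 * kappa))%:E <= d_%:E)%E.
  apply: le_trans h; rewrite leeD2l//.
  (* Regularity bounds the residual below by [d_^2 / kappa], so the decrease is at least a fixed
     fraction of [d_]. *)
  have -> : b * d_ / (2 * kappa) = b / (2 * d_) * (kappa^-1 * d_ ^+ 2).
    by field; rewrite !gt_eqF.
  rewrite EFinM lee_wpmul2l ?lee_fin//.
  by rewrite EFinM lee_pdivrMl// regularity.
rewrite -leeBrDr// -EFinB -EFinM => h'; apply: le_trans h' _.
by rewrite lee_fin mulrBl mul1r mulrAC.
Qed.

End stochastic_fixed_points.

(** * A lower bound for the Wasserstein distance *)

Lemma dist_le_wasserstein (R : realType) (H : completeNormedModType R)
    (C : set H) (nu1 nu2 : probability (borel H) R) :
  separable_space H -> closed C -> nu2 C = 1%E ->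
  (\int[nu1]_x (dist (x : H) C)%:E <= wasserstein nu1 nu2)%E.
Proof.
move=> sepH cC nu2C; apply: le_ereal_inf_tmp.
move=> _ [d [Om [P [Y1 [Y2 [Y1nu Y2nu ->]]]]]].
have mdist : measurable_fun [set: borel H] (fun x => (dist (x : H) C)%:E).
  by apply/measurable_EFinP; exact: measurable_dist.
rewrite -(has_law_ge0_integral Y1nu mdist); last first.
  by move=> x; rewrite lee_fin dist_ge0.
rewrite unlock; apply: ae_ge0_le_integral => //.
- by move=> w _; rewrite lee_fin dist_ge0.
- exact: measurableT_comp mdist (measurable_funP Y1).
- apply/measurable_EFinP; apply: measurable_fun_norm_sub => //;
    exact: measurable_funP.
- have /(probability1P nu2 (closed_borel_measurable cC)) CY2 := nu2C.
  have : \forall w \ae P, C (Y2 w) := has_law_ae Y2nu CY2.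
  by apply: filterS => w {}CY2 _; rewrite lee_fin dist_le.
Qed.

(** * Geometric decay along the random iteration *)

Section random_function_iteration.
Context (R : realType) (H : completeNormedModType R).
Context d d' (Om : measurableType d) (I : measurableType d').
Context (P : probability Om R) (xi : {RV P >-> I}) (xi_ : nat -> {RV P >-> I}).
Context (T : I -> H -> H) (X_ : nat -> {RV P >-> borel H}).
Context (mT : measurable_fun [set: borel H * I] (fun p => T p.2 p.1 : borel H)).
Context (xi_law : forall k, has_law (xi_ k) (distribution P xi)).
Context (X0_xi_independent :
  forall k, mutually_independent P (sigma_inputs (X_ 0%N) xi_ (k := k))).
Context (X_iteration : forall k w, X_ k.+1 w = T (xi_ k w) (X_ k w)).

(** Both [X_ 0] and [X_ k] are measurable for the sigma-algebra generated by [past k]. The pair is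
    needed because the weight depends on [X_ 0]. *)
Lemma independent_iterates k (A : set (borel H * borel H)) (B : set I) :
  measurable A -> measurable B ->
  (P ((fun w => (X_ 0%N w, X_ k w)) @^-1` A `&` xi_ k @^-1` B) =
   P ((fun w => (X_ 0%N w, X_ k w)) @^-1` A) * P (xi_ k @^-1` B))%E.
Proof.
move=> mA mB; apply: independent_past => //.
pose Om_ := g_sigma_algebraType (past (X_ 0%N) xi_ k).
have mX0 : measurable_fun [set: Om_] (X_ 0%N).
  move=> _ D mD; apply: sub_sigma_algebra.
  by apply: (@sub_past _ _ _ _ _ _ _ _ _ _ None) => //; exists D.
have mXk : measurable_fun [set: Om_] (X_ k).
  apply: (@iteration_measurable _ _ _ _ Om_ I T (fun k => X_ k : Om_ -> borel H)
    (fun k => xi_ k : Om_ -> I)) => // j jk _ D mD.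
  apply: sub_sigma_algebra.
  (* As [j < k], this index differs from [ord_max], so the event lies in the past. *)
  apply: (@sub_past _ _ _ _ _ _ _ _ _ _
    (Some (Ordinal (ltnW jk : (j < k.+1)%N)))).
    by apply/eqP => -[] /eqP; rewrite ltn_eqF.
  by exists D.
have := measurable_fun_pair mX0 mXk measurableT mA.
by rewrite setTI.
Qed.

Context (C : set H) (r : R) (r0 : 0 <= r).
Context (contraction : forall x,
  (\int[distribution P xi]_i (dist (T i x) C)%:E <= r%:E * (dist x C)%:E)%E).

Section weighted_dist.
Context (g : H -> R) (g0 : forall x, 0 <= g x).
Context (mg : measurable_fun [set: borel H] g).

Let mdist := measurable_dist C.

Lemma measurable_weighted_dist k :
  measurable_fun [set: Om] (fun w => (g (X_ 0%N w) * dist (X_ k w : H) C)%:E).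
Proof.
apply/measurable_EFinP; apply: measurable_funM.
  exact: measurableT_comp mg (measurable_funP _).
exact: measurableT_comp mdist (measurable_funP _).
Qed.

(** By independence the step from [X_ k] is averaged over the law of [xi] with [(X_ 0, X_ k)]
    frozen; the weight leaves the inner integral and the contraction applies pointwise. *)
Lemma weighted_dist_step k :
  (\int[P]_w (g (X_ 0%N w) * dist (X_ k.+1 w : H) C)%:E <=
   r%:E * \int[P]_w (g (X_ 0%N w) * dist (X_ k w : H) C)%:E)%E.
Proof.
have mY : measurable_fun [set: Om] (fun w => (X_ 0%N w, X_ k w)).
  by apply: measurable_fun_pair; exact: measurable_funP.
pose Y : {RV P >-> (borel H * borel H)%type} := mfun_Sub (mem_set mY).
pose F (p : borel H * borel H * I) := (g p.1.1 * dist (T p.2 p.1.2) C)%:E.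
have mF : measurable_fun [set: borel H * borel H * I] F.
  apply/measurable_EFinP; apply: measurable_funM.
    apply: (measurableT_comp mg).
    exact: (measurableT_comp measurable_fst measurable_fst).
  apply: (measurableT_comp mdist).
  apply: (measurableT_comp mT
    (g := fun p : borel H * borel H * I => (p.1.2, p.2))).
  apply: measurable_fun_pair => //.
  exact: (measurableT_comp measurable_snd measurable_fst).
have F0 p : (0 <= F p)%E by rewrite lee_fin mulr_ge0 ?dist_ge0.
have -> : (\int[P]_w (g (X_ 0%N w) * dist (X_ k.+1 w : H) C)%:E =
           \int[P]_w F (Y w, xi_ k w))%E.
  by apply: eq_integral => w _; rewrite X_iteration.
rewrite (@ge0_integral_independent _ _ _ _ _ _ _ _ Y (xi_ k))//; last first.
  exact: independent_iterates.
rewrite -ge0_integralZl_EFin//; last 2 first.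
- by move=> w _; rewrite lee_fin mulr_ge0 ?dist_ge0.
- exact: measurable_weighted_dist.
apply: ge0_le_integral => //.
- by move=> w _; exact: integral_ge0.
- have mG := measurable_fun_fubini_tonelli_F
    (m2 := distribution P (xi_ k)) F mF F0.
  exact: measurableT_comp mG (measurable_funP Y).
- by apply: measurable_funeM; exact: measurable_weighted_dist.
move=> w _; rewrite /F /=.
rewrite (eq_measure_integral (distribution P xi)); last first.
  by move=> A mA _; exact: xi_law.
under eq_integral do rewrite EFinM.
rewrite ge0_integralZl_EFin//; last 2 first.
- by move=> i _; rewrite lee_fin dist_ge0.
- apply/measurable_EFinP.
  exact: measurableT_comp mdist (measurable_evalT mT _).
by rewrite EFinM muleCA lee_wpmul2l ?lee_fin.
Qed.

Lemma weighted_dist_geometric k :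
  (\int[P]_w (g (X_ 0%N w) * dist (X_ k w : H) C)%:E <=
   (r ^+ k)%:E * \int[P]_w (g (X_ 0%N w) * dist (X_ 0%N w : H) C)%:E)%E.
Proof.
elim: k => [|k IH]; first by rewrite expr0 mul1e.
apply: le_trans (weighted_dist_step k) _.
by rewrite exprS EFinM -muleA lee_wpmul2l ?lee_fin.
Qed.

End weighted_dist.

(* The weight [1 / (1 + dist (X_ 0 w) C)] makes the expectations finite
   whatever the law of [X_ 0]. *)
Lemma ae_dist_small : r < 1 ->
  \forall w \ae P, forall e, 0 < e -> exists k, dist (X_ k w : H) C < e.
Proof.
move=> r1; pose g (x : H) : R := (1 + dist x C)^-1.
have d1 (x : H) : 0 < 1 + dist x C by rewrite ltr_wpDr ?dist_ge0.
have gp x : 0 < g x by rewrite invr_gt0.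
have g0 x : 0 <= g x by exact: ltW.
have mg : measurable_fun [set: borel H] g.
  apply: continuous_borel_measurable => x; apply: cvgV; first by rewrite gt_eqF.
  by apply: cvgD; [exact: cvg_cst|exact: dist_continuous].
pose f k w := (g (X_ 0%N w) * dist (X_ k w : H) C)%:E.
have f0 k w : (0 <= f k w)%E by rewrite lee_fin mulr_ge0 ?dist_ge0.
have mf k : measurable_fun [set: Om] (f k) by exact: measurable_weighted_dist.
(* The infimum over all [k] of the weighted distances: its mean is at most [r ^+ k] for every [k],
   hence zero. *)
pose h w := einfs (f ^~ w) 0.
have mh : measurable_fun [set: Om] h by exact: measurable_fun_einfs.
have h0 w : (0 <= h w)%E by apply: le_ereal_inf_tmp => _ [k _ <-].
have hf w k : (h w <= f k w)%E by apply: ereal_inf_lbound; exists k.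
have Eh k : (\int[P]_w h w <= (r ^+ k)%:E)%E.
  apply: (@le_trans _ _ (\int[P]_w f k w)%E).
    by apply: ge0_le_integral.
  apply: le_trans (weighted_dist_geometric g0 mg k) _.
  rewrite -[leRHS]mule1 lee_wpmul2l ?lee_fin ?exprn_ge0//.
  apply: (@le_trans _ _ (\int[P]_w (cst 1%E) w)%E).
    apply: ge0_le_integral; [by []|exact: (fun w _ => f0 0%N w)|exact: mf|
      by []|].
    by move=> w _; rewrite lee_fin /g ler_pdivrMl// mulr1 lerDr.
  by rewrite integral_cst//; have /= -> := probability_setT P; rewrite mule1.
have Eh0 : (\int[P]_w `|h w| = 0)%E.
  under eq_integral do rewrite gee0_abs//.
  apply/eqP; rewrite eq_le integral_ge0// andbT.
  apply: (@cvge_to_ge _ \oo _ _ (fun k => (r ^+ k)%:E)); last exact: nearW.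
  by apply: cvg_EFin; [exact: nearW|apply: cvg_expr; rewrite ger0_norm].
have : ae_eq P setT h (cst 0%E) by apply/ae_eq_integral_abs.
apply: filterS => w /(_ Logic.I) /= hw e e0.
(* The weight is positive, so it can be cancelled once some weighted distance is below this
   level. *)
have : (h w < (g (X_ 0%N w) * e)%:E)%E by rewrite hw lte_fin mulr_gt0.
move=> /ereal_inf_lt[_ [k _ <-]]; rewrite lte_fin ltr_pM2l// => ke.
by exists k.
Qed.

Lemma wasserstein_geometric (X : {RV P >-> borel H}) :
  separable_space H -> closed C -> P (X @^-1` C) = 1%E ->
  (\forall w \ae P, forall k,
    `|(X_ k w : H) - (X w : H)| <= 2 * dist (X_ k w : H) C) ->
  forall k, (wasserstein (distribution P (X_ k)) (distribution P X)
    <= (2 * r ^+ k)%:E *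
       wasserstein (distribution P (X_ 0%N)) (distribution P X))%E.
Proof.
move=> sepH cC XC XkX k.
have md j : measurable_fun [set: Om] (fun w => (dist (X_ j w : H) C)%:E).
  apply/measurable_EFinP.
  exact: measurableT_comp (measurable_dist C) (measurable_funP _).
(* The pair [(X_ k, X)] on [Om] is itself a coupling. *)
apply: (@le_trans _ _ ('E_P[fun w => `|(X_ k w : H) - (X w : H)|%R])%E).
  by apply: ereal_inf_lbound; exists d, Om, P, (X_ k), X.
rewrite unlock.
apply: (@le_trans _ _ (\int[P]_w (2%:E * (dist (X_ k w : H) C)%:E))%E).
  apply: ae_ge0_le_integral => //.
  - apply/measurable_EFinP; apply: measurable_fun_norm_sub => //;
      exact: measurable_funP.
  - by move=> w _; rewrite -EFinM lee_fin mulr_ge0 ?dist_ge0.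
  - exact: measurable_funeM.
  - by apply: filterS XkX => w XkX _; rewrite -EFinM lee_fin.
rewrite ge0_integralZl_EFin//; last by move=> w _; rewrite lee_fin dist_ge0.
rewrite EFinM -muleA lee_wpmul2l ?lee_fin//.
have E1 j : (\int[P]_w (cst 1 (X_ 0%N w) * dist (X_ j w : H) C)%:E =
             \int[P]_w (dist (X_ j w : H) C)%:E)%E.
  by apply: eq_integral => w _; rewrite mul1r.
have := weighted_dist_geometric (g := cst 1) (fun=> ler01) (measurable_cst _) k.
rewrite !E1 => /le_trans; apply; rewrite lee_wpmul2l ?lee_fin ?exprn_ge0//.
have := dist_le_wasserstein (distribution P (X_ 0%N)) sepH cC
  (nu2 := distribution P X) XC.
rewrite ge0_integral_distribution//.
  by apply/measurable_EFinP; exact: measurable_dist.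
by move=> x; rewrite lee_fin dist_ge0.
Qed.

End random_function_iteration.

(** * Choice of the constants and construction of the limit *)

Theorem theorem3p12
  (R : realType) (H : completeNormedModType R)
  (H_hilbert : hilbert_space H) (H_separable : separable_space H)
  (dI : measure_display) (I : measurableType dI)
  (T : I -> H -> H)
  (T_continuous : forall i : I, continuous (T i))
  (Phi_measurable :
     measurable_fun [set: borel H * I] (fun p => T p.2 p.1 : borel H))
  (dO : measure_display) (Omega : measurableType dO) (P : probability Omega R)
  (xi : {RV P >-> I}) (xi_ : nat -> {RV P >-> I})
  (xi_identically_distributed : forall k : nat, has_law (xi_ k) (distribution P xi))
  (mu : probability (borel H) R) (X_ : nat -> {RV P >-> borel H})
  (X0_law : has_law (X_ 0%N) mu)
  (X0_xi_independent :
     forall k : nat, mutually_independent P (sigma_inputs (X_ 0%N) xi_ (k := k)))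
  (X_iteration :
     forall (k : nat) (w : Omega), X_ k.+1 w = T (xi_ k w) (X_ k w))
  (alpha_ : I -> R) (alpha : R)
  (T_averaged : forall i : I, averaged (alpha_ i) (T i))
  (alpha_le : forall i : I, alpha_ i <= alpha) (alpha_lt1 : alpha < 1)
  (C_nonempty : stochastic_fix T xi !=set0)
  (kappa : R) (kappa_gt0 : 0 < kappa)
  (regularity : forall x : H,
     ((dist x (stochastic_fix T xi) ^+ 2)%:E <= kappa%:E * residual T xi x)%E) :
  exists X : {RV P >-> borel H},
    {ae P, forall w : Omega, (fun k => X_ k w : H) @ \oo --> (X w : H)} /\
    exists r : R, 0 < r < 1 /\
      forall k : nat,
        (wasserstein (distribution P (X_ k)) (distribution P X)
         <= (2 * r ^+ k)%:E *
            wasserstein (distribution P (X_ 0%N)) (distribution P X))%E.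
Proof.
set C := stochastic_fix T xi in C_nonempty regularity *.
have T1 i x y : `|T i x - T i y| <= `|x - y|.
  exact: averaged_nonexpansive (T_averaged i).
(* [I] is pointed, so at least one positive [alpha_ i] lies below [alpha]. *)
have alpha_gt0 : 0 < alpha.
  have [/andP[a0 _] _] := T_averaged point.
  exact: lt_le_trans a0 (alpha_le point).
(* [(1 - a) / a] decreases in [a], so its value at [alpha] serves for all [i]. *)
pose b := (1 - alpha) / alpha.
have b0 : 0 < b by rewrite divr_gt0// subr_gt0.
have Tb i x y : `|T i x - T i y| ^+ 2 + b * `|(x - T i x) - (y - T i y)| ^+ 2
    <= `|x - y| ^+ 2.
  have [/andP[a0 a1] /(_ x y)] := T_averaged i.
  apply: le_trans; rewrite lerD2l ler_wpM2r ?sqr_ge0//.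
  rewrite /b !mulrBl !mul1r !divff ?gt_eqF// lerD2r lef_pV2//.
(* Regularity survives enlarging [kappa] since the residual is nonnegative; [b <= kappa'] keeps [r]
   at least [1 / 2]. *)
pose kappa' := Num.max kappa b.
have kappa'_gt0 : 0 < kappa' by rewrite lt_max b0 orbT.
have reg' x : ((dist x C ^+ 2)%:E <= kappa'%:E * residual T xi x)%E.
  apply: le_trans (regularity x) _; apply: lee_wpmul2r.
    by rewrite /residual unlock integral_ge0// => w _; rewrite lee_fin sqr_ge0.
  by rewrite lee_fin le_max lexx.
pose r := 1 - b / (2 * kappa').
have r_lt1 : r < 1 by rewrite /r ltrBlDr ltrDl divr_gt0// mulr_gt0.
have r_gt0 : 0 < r.
  rewrite subr_gt0 ltr_pdivrMr ?mulr_gt0// mul1r.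
  have : b <= kappa' by rewrite le_max lexx orbT.
  by lra.
have contraction x :
    (\int[distribution P xi]_i (dist (T i x) C)%:E <= r%:E * (dist x C)%:E)%E.
  by apply: dist_contraction => //; rewrite le_max lexx orbT.
have cC : closed C := closed_stochastic_fix Phi_measurable T1 H_separable.
have [c0 Cc0] := C_nonempty.
have small := ae_dist_small Phi_measurable xi_identically_distributed
  X0_xi_independent X_iteration (ltW r_gt0) contraction r_lt1.
have fixes : \forall w \ae P, forall k c, C c -> T (xi_ k w) c = c.
  apply: ae_foralln => k.
  have := ae_Fix_stochastic_fix xi Phi_measurable T1 H_separable.
  exact: has_law_ae (xi_identically_distributed k).
have [N [mN N0 NP]] : \forall w \ae P, exists l : H, [/\ C l,
    (fun k => X_ k w : H) @ \oo --> l &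
    forall k, `|(X_ k w : H) - l| <= 2 * dist (X_ k w : H) C].
  apply: filterS2 small fixes => w smallw fixw; apply: fejer_cvg => //.
  by move=> c k Cc; rewrite X_iteration -[in leLHS](fixw k c Cc).
(* On the null set [N] the iterates are replaced by [c0]. They then converge everywhere, which makes
   the limit measurable, and the limit lies in [C] everywhere. *)
have goodP w : exists l : H, [/\ C l,
    (fun k => if w \in N then c0 else X_ k w) @ \oo --> l &
    w \notin N -> forall k, `|(X_ k w : H) - l| <= 2 * dist (X_ k w : H) C].
  have [wN|wN] := boolP (w \in N).
    by exists c0; split => //; exact: cvg_cst.
  have [l lP] : exists l : H, [/\ C l,
      (fun k => X_ k w : H) @ \oo --> l &
      forall k, `|(X_ k w : H) - l| <= 2 * dist (X_ k w : H) C].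
    by apply: contrapT => nex; move/negP: wN; apply; rewrite inE; exact: NP.
  by exists l; case: lP.
have {goodP}[X_lim X_limP] := choice goodP.
have mX : measurable_fun [set: Omega] (X_lim : Omega -> borel H).
  apply: (borel_measurable_cvg
    (h := fun k w => if w \in N then c0 : borel H else X_ k w)); last first.
    by move=> w; case: (X_limP w).
  move=> k; apply: measurable_fun_ifT.
  - apply: (measurable_fun_bool true); rewrite setTI.
    rewrite (_ : _ @^-1` _ = N)//.
    by apply/seteqP; split=> w; [move/set_mem|move/mem_set].
  - exact: measurable_cst.
  - exact: measurable_funP.
pose X : {RV P >-> borel H} := mfun_Sub (mem_set mX).
exists X; split.
  exists N; split => // w nX; apply: contrapT => wN; apply: nX.
  by case: (X_limP w) => _ + _; rewrite memNset.
exists r; split; first by rewrite r_gt0.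
have XC : X @^-1` C = setT.
  by apply/seteqP; split => // w _; case: (X_limP w).
have XkX : \forall w \ae P, forall k,
    `|(X_ k w : H) - (X w : H)| <= 2 * dist (X_ k w : H) C.
  exists N; split => // w nX; apply: contrapT => wN; apply: nX.
  by case: (X_limP w) => _ _; apply; rewrite memNset.
apply: (wasserstein_geometric Phi_measurable xi_identically_distributed
  X0_xi_independent X_iteration (ltW r_gt0) contraction H_separable cC _ XkX).
by rewrite XC probability_setT.
Qed.
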